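(* For all real $\mu\ge0$ and all $x\in\mathbb{R}$, $x\neq0$, $$\int_{-1}^1e^{xt/2}\left(1-t^2\right)^{\mu-1/2}\ln\left(1-t^2\right)dt=\mathrm{B}\left(\mu+\tfrac12,\mu+\tfrac12\right)\Gamma(1+\mu)\left(\frac{16}{|x|}\right)^{\mu}\left\{I_\mu\left(\frac{|x|}{2}\right)\left[\psi\left(\mu+\tfrac12\right)+\ln\left(\frac{4}{|x|}\right)\right]+\frac{\partial I_\mu(|x|/2)}{\partial\mu}\right\}.$$
   Context: $\mathrm{B}(a,b)=\Gamma(a)\Gamma(b)/\Gamma(a+b)$ is the beta function, $\psi=\Gamma'/\Gamma$ the digamma function, $I_\mu$ the modified Bessel function of the first kind, and $\frac{\partial I_\mu(|x|/2)}{\partial\mu}$ is the derivative of $I_\mu$ with respect to its order at fixed argument $|x|/2$. *)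

(* Defs.v *)
From mathcomp Require Import all_boot all_order all_algebra.
From mathcomp Require Import all_classical all_reals all_analysis.

Set Implicit Arguments.
Unset Strict Implicit.
Unset Printing Implicit Defensive.

Import Order.TTheory GRing.Theory Num.Theory.
Import numFieldNormedType.Exports.

Local Open Scope classical_set_scope.
Local Open Scope ring_scope.

(* Euler's integral, meaningful for 0 < a; its analytic continuation to
   negative a is not modelled. *)
Definition Gamma {R : realType} (a : R) : R :=
  \int[lebesgue_measure]_(t in `]0, +oo[) (t `^ (a - 1) * expR (- t)).

Definition Beta {R : realType} (a b : R) : R :=
  Gamma a * Gamma b / Gamma (a + b).

Definition digamma {R : realType} (a : R) : R := derive1 Gamma a / Gamma a.

(* Modified Bessel function of the first kind I_nu(z), for 0 < z and
   -1 < nu: in this range every argument of Gamma below is positive. The range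
   contains a two-sided neighbourhood of each nu >= 0, so that the derivative in
   the order is an ordinary one, also at nu = 0. *)
Definition BesselI {R : realType} (nu z : R) : R :=
  limn (series (fun k : nat =>
    (z / 2) `^ (2 * k%:R + nu) / (k`!%:R * Gamma (nu + k%:R + 1)))).

Definition dBesselI_order {R : realType} (nu z : R) : R :=
  derive1 (fun m : R => BesselI m z) nu.

(* Main.v *)
Require Import Defs.
From mathcomp Require Import all_boot all_order all_algebra.
From mathcomp Require Import all_classical all_reals all_analysis.
From mathcomp Require Import measurable_realfun ring lra.

(* Let J(s) be the integral of (1 - t^2)^(s-1) exp(xt/2) over (-1,1). Expanding
   the exponential, the odd terms cancel and the even ones are Beta integrals,
   which gives Poisson's formula
     J(m + 1/2) = Gamma(1/2) Gamma(m + 1/2) (4/|x|)^m I_m(|x|/2)   (m > -1/2).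
   Differentiating J under the integral sign at s = mu + 1/2 inserts the factor
   ln(1 - t^2); since Gamma is differentiable too, Poisson's formula shows that
   I_m is differentiable in m and yields the claim, the prefactor being
   rewritten with the duplication formula 2^(2s-1) B(s,s) = B(s,1/2). *)

Set Implicit Arguments.
Unset Strict Implicit.
Unset Printing Implicit Defensive.

Import Order.TTheory GRing.Theory Num.Theory.
Import numFieldNormedType.Exports.

Local Open Scope classical_set_scope.
Local Open Scope ring_scope.

(** * Increasing substitutions on open intervals *)

(** The order enters every term of the Bessel series, and no term-by-term differentiation is done:
    near [mu] the series is replaced by a product of functions already known to be differentiable.
    This is why Poisson's formula is wanted for all real m > -1/2, an open range that surrounds each
    mu >= 0, the end point 0 included. Gamma being given only as Euler's integral, its finiteness
    comes from comparison with an explicit Beta integral, and its functional equation and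
    half-integer values from the Gamma-Beta identity. The integrands may be singular at the ends of
    their intervals; as they are nonnegative, substitutions are made on compact segments and passed
    to the limit by monotone convergence. One lemma on integrals of v^(s-1) w, differentiated in s,
    serves both Gamma and J. *)

Lemma for_continuous_measurable_fun {R : realType} (D : set R) (f : R -> R) :
  measurable D -> (forall x, D x -> {for x, continuous f}) ->
  measurable_fun D f.
Proof.
move=> mD cf; apply: subspace_continuous_measurable_fun => //.
by apply: continuous_in_subspaceT => x /[!inE] /cf.
Qed.

Section substitution.
Context {R : realType}.
Implicit Types (a b : nat -> R) (D E : set R) (F f G : R -> R).

(** Closed segments stay away from the ends of an open [D], where integrands may be singular; their
    monotonicity is what monotone convergence asks for. *)
Definition exhausts a b D :=
  [/\ nonincreasing_seq a, nondecreasing_seq b, forall n, a n < b n &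
      \bigcup_n `[a n, b n]%classic = D].

(** The substitution rule speaks of [derive1 F], which is known to equal [f] only on the segment;
    each limit, one-sided at the ends, is therefore taken from inside. *)
Lemma segment_subst_increasing F f G (p q : R) : p < q ->
  (forall x, x \in `[p, q] -> is_derive x 1 F (f x)) ->
  (forall x, x \in `[p, q] -> {for x, continuous f}) ->
  {in `[p, q] &, {homo F : x y / x < y}} ->
  (forall y, y \in `[F p, F q] -> {for y, continuous G}) ->
  (\int[lebesgue_measure]_(y in `[F p, F q]) (G y)%:E =
   \int[lebesgue_measure]_(x in `[p, q]) (G (F x) * f x)%:E)%E.
Proof.
move=> pq dF cf incF cG.
have Ff x : x \in `[p, q] -> derive1 F x = f x.
  by move=> /dF dFx; rewrite derive1E derive_val.
have cF x : x \in `[p, q] -> {for x, continuous F}.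
  by move=> /dF dFx; apply: differentiable_continuous; exact/derivable1_diffP.
have p_in : p \in `[p, q] by rewrite in_itv/= lexx ltW.
have q_in : q \in `[p, q] by rewrite in_itv/= lexx ltW.
rewrite integration_by_substitution_increasing//.
- by apply: eq_integral => x /[!inE] xpq; rewrite /= !fctE Ff.
- exact: ltW.
- move=> x xpq; have xpq' : x \in `[p, q] by exact: subset_itv_oo_cc.
  rewrite /continuous_at Ff//; apply: cvg_trans (cf _ xpq').
  apply: near_eq_cvg; near=> y; rewrite Ff//; apply: subset_itv_oo_cc.
  by near: y; exact: near_in_itvoo.
- apply/cvg_ex; exists (f p).
  apply: cvg_trans (cvg_at_right_filter (cf _ p_in)).
  apply: near_eq_cvg; near=> y; rewrite Ff//; apply: subset_itv_oo_cc.
  by rewrite in_itv/=; apply/andP; split; near: y; [exact: nbhs_right_gt|exact: nbhs_right_lt].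
- apply/cvg_ex; exists (f q).
  apply: cvg_trans (cvg_at_left_filter (cf _ q_in)).
  apply: near_eq_cvg; near=> y; rewrite Ff//; apply: subset_itv_oo_cc.
  by rewrite in_itv/=; apply/andP; split; near: y; [exact: nbhs_left_gt|exact: nbhs_left_lt].
- split.
  + by move=> x /subset_itv_oo_cc/dF.
  + by apply: cvg_at_right_filter; exact: cF.
  + by apply: cvg_at_left_filter; exact: cF.
- by apply: continuous_in_subspaceT => y /[!inE] yE; exact: cG.
Unshelve. all: by end_near. Qed.

(** Monotone convergence on both sides of the rule for segments. The segments between [F (a n)] and
    [F (b n)] lie in [E] because [E] is an interval, and they fill it because [F] maps [D] onto
    it. *)
Lemma ge0_subst_increasing F f G a b D E : exhausts a b D ->
  is_interval E -> F @` D = E ->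
  (forall x, D x -> is_derive x 1 F (f x)) ->
  (forall x, D x -> 0 < f x) ->
  (forall x, D x -> {for x, continuous f}) ->
  (forall y, E y -> 0 <= G y) ->
  (forall y, E y -> {for y, continuous G}) ->
  (\int[lebesgue_measure]_(y in E) (G y)%:E =
   \int[lebesgue_measure]_(x in D) (G (F x) * f x)%:E)%E.
Proof.
move=> [a_decr b_incr ab DE] itvE FDE dF f_gt0 cf G_ge0 cG.
have abD n x : x \in `[a n, b n] -> D x by rewrite -DE => xn; exists n.
have DFE x : D x -> E (F x) by move=> Dx; rewrite -FDE; exists x.
have incF n : {in `[a n, b n] &, {homo F : x y / x < y}}.
  move=> x y xn yn xy; apply: (@gtr0_derive1_lt_cc _ F (a n) (b n)) => //.
  - by move=> z /subset_itv_oo_cc/abD/dF.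
  - move=> z /subset_itv_oo_cc/abD Dz; rewrite derive1E.
    by have Fz := dF _ Dz; rewrite derive_val f_gt0.
  - by apply: derivable_within_continuous => z /abD/dF.
have aI n : a n \in `[a n, b n] by rewrite in_itv/= lexx ltW.
have bI n : b n \in `[a n, b n] by rewrite in_itv/= lexx ltW.
have FabE n y : y \in `[F (a n), F (b n)] -> E y.
  rewrite in_itv/=; apply: itvE; apply: DFE; [exact: (abD n)|exact: (abD n)].
have leF n x y : x \in `[a n, b n] -> y \in `[a n, b n] -> x <= y -> F x <= F y.
  by move=> xn yn; rewrite le_eqVlt => /predU1P[->//|xy]; exact/ltW/(incF n).
have sub m n : (m <= n)%N -> `[a m, b m]%classic `<=` `[a n, b n].
  by move=> mn; apply: subset_itv; rewrite bnd_simp ?a_decr ?b_incr.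
have UE : \bigcup_n `[F (a n), F (b n)]%classic = E.
  rewrite eqEsubset; split=> [y [n _ /FabE]//|y].
  rewrite -FDE => -[x]; rewrite -DE => -[n _ /= xn <-]; exists n => //=.
  have /andP[ax xb] : a n <= x <= b n by move: xn; rewrite in_itv.
  by rewrite in_itv/= (leF n)//= (leF n).
have cF x : D x -> {for x, continuous F}.
  by move=> /dF dFx; apply: differentiable_continuous; exact/derivable1_diffP.
have cvgE : (\int[lebesgue_measure]_(y in `[F (a n), F (b n)]) (G y)%:E @[n --> \oo]
    --> \int[lebesgue_measure]_(y in E) (G y)%:E)%E.
  rewrite -UE; apply: ge0_nondecreasing_set_cvg_integral => //.
  - move=> m n mn; rewrite subsetEset; apply: subset_itv; rewrite bnd_simp.
    + by apply: (leF n); [exact: aI|exact: (sub m n mn _ (aI m))|exact: a_decr].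
    + by apply: (leF n); [exact: (sub m n mn _ (bI m))|exact: bI|exact: b_incr].
  - move=> n; apply/measurable_EFinP; apply: for_continuous_measurable_fun => //.
    by move=> y Iy; exact/cG/(FabE n).
  - by move=> n y /(FabE n) Ey; rewrite lee_fin G_ge0.
have cvgD : (\int[lebesgue_measure]_(x in `[a n, b n]) (G (F x) * f x)%:E @[n --> \oo]
    --> \int[lebesgue_measure]_(x in D) (G (F x) * f x)%:E)%E.
  rewrite -DE; apply: ge0_nondecreasing_set_cvg_integral => //.
  - by move=> m n mn; rewrite subsetEset; exact: sub.
  - move=> n; apply/measurable_EFinP; apply: for_continuous_measurable_fun => //.
    move=> x /(abD n) Dx.
    by apply: continuousM; [apply: continuous_comp; [exact: cF|exact/cG/DFE]|exact: cf].
  - by move=> n x /(abD n) Dx; rewrite lee_fin mulr_ge0// ?G_ge0 ?ltW ?f_gt0//; exact: DFE.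
apply: (cvg_unique _ cvgE) => //; apply: cvg_trans cvgD.
apply: near_eq_cvg; near=> n; apply/esym/segment_subst_increasing; first exact: ab.
- by move=> x /abD/dF.
- by move=> x /abD/cf.
- exact: incF.
- by move=> y /FabE/cG.
Unshelve. all: by end_near. Qed.

End substitution.

(** * Exhausting bounded and half-infinite open intervals *)

Section exhaustions.
Context {R : realType}.
Implicit Types p q : R.

(** With [n.+3] the two margins together take at most 2/3 of the length, so the segment is
    nondegenerate already at n = 0. *)
Lemma exhausts_oo p q : p < q ->
  exhausts (fun n => p + (q - p) / n.+3%:R) (fun n => q - (q - p) / n.+3%:R)
    `]p, q[.
Proof.
move=> pq; have qp : 0 < q - p by rewrite subr_gt0.
have decr m n : (m <= n)%N -> (q - p) / n.+3%:R <= (q - p) / m.+3%:R.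
  by move=> mn; rewrite ler_pM2l// lef_pV2 ?posrE// ler_nat !ltnS.
have small n : (q - p) / n.+3%:R * 2 < q - p.
  by rewrite -mulrA gtr_pMr// mulrC ltr_pdivrMr// mul1r ltr_nat.
split.
- by move=> m n mn; rewrite lerD2l decr.
- by move=> m n mn; rewrite lerD2l lerN2 decr.
- by move=> n /=; have := small n; set e := _ / _; lra.
apply/seteqP; split=> [x [n _]|x]; rewrite /= !in_itv/= => /andP[px xq].
  have : 0 < (q - p) / n.+3%:R by rewrite divr_gt0.
  by set e := _ / _ in px xq * => ?; apply/andP; split; lra.
have e_gt0 : 0 < Num.min (x - p) (q - x) / (q - p).
  by rewrite divr_gt0// lt_min !subr_gt0 px.
near \oo => n; exists n => //=.
have : n.+3%:R^-1 < Num.min (x - p) (q - x) / (q - p).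
  have : n.+1%:R^-1 < Num.min (x - p) (q - x) / (q - p).
    by near: n; exact: near_infty_natSinv_lt (PosNum e_gt0).
  by apply: le_lt_trans; rewrite lef_pV2 ?posrE// ler_nat !ltnS leqW.
rewrite ltr_pdivlMr// mulrC lt_min; set e := _ / _ => /andP[? ?].
by rewrite in_itv/= -/e; apply/andP; split; lra.
Unshelve. all: by end_near. Qed.

Lemma exhausts_oy p :
  exhausts (fun n => p + n.+1%:R^-1) (fun n => p + n.+2%:R) `]p, +oo[.
Proof.
split.
- by move=> m n mn; rewrite lerD2l lef_pV2 ?posrE// ler_nat.
- by move=> m n mn; rewrite lerD2l ler_nat.
- move=> n; rewrite ltrD2l (@le_lt_trans _ _ 1) ?ltr1n//.
  by rewrite invf_le1// ler1n.
apply/seteqP; split=> [x [n _]|x]; rewrite /= !in_itv/= ?andbT.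
  by case/andP=> + _; apply: lt_le_trans; rewrite ltrDl.
move=> px; have e_gt0 : 0 < x - p by rewrite subr_gt0.
near \oo => n; exists n => //=; rewrite in_itv/=; apply/andP; split.
  rewrite -lerBrDl ltW//.
  by near: n; exact: near_infty_natSinv_lt (PosNum e_gt0).
rewrite -lerBlDl; apply: (@le_trans _ _ n%:R).
  by near: n; exact: nbhs_infty_ger.
by rewrite ler_nat -addn2 leq_addr.
Unshelve. all: by end_near. Qed.

End exhaustions.

(** * Derivative instances and Tonelli's theorem on a rectangle *)

Lemma is_derive_continuous {R : realType} (f : R -> R) (x df : R) :
  is_derive x 1 f df -> {for x, continuous f}.
Proof. by move=> fx; apply: differentiable_continuous; exact/derivable1_diffP. Qed.

#[local] Instance is_derive1_powR_comp {R : realType} (p : R) (g : R -> R)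
    (x dg : R) :
  0 < g x -> is_derive x 1 g dg ->
  is_derive x 1 (fun y => g y `^ p) (p * g x `^ (p - 1) * dg).
Proof.
move=> gx dgx.
exact: (@is_derive1_comp _ (@powR R ^~ p) g _ _ _ (is_derive1_powR p gx) dgx).
Qed.

(* Instance search thus finds the positive base of a power among the hypotheses, which is why
   positivity facts are stated just before a derivative is computed. *)
#[local] Hint Extern 0 (is_true (0 < _)) => assumption : typeclass_instances.

(** Extension of [h] by zero outside the rectangle reduces this to Tonelli's theorem on the whole
    product. *)
Lemma fubini_tonelli_setX d1 d2 (T1 : measurableType d1) (T2 : measurableType d2)
    (R : realType) (m1 : {sigma_finite_measure set T1 -> \bar R})
    (m2 : {sigma_finite_measure set T2 -> \bar R})
    (A : set T1) (B : set T2) (h : T1 -> T2 -> \bar R) :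
  measurable A -> measurable B ->
  measurable_fun (A `*` B) (fun z => h z.1 z.2) ->
  (forall x y, A x -> B y -> 0 <= h x y)%E ->
  (\int[m1]_(x in A) \int[m2]_(y in B) h x y =
   \int[m2]_(y in B) \int[m1]_(x in A) h x y)%E.
Proof.
move=> mA mB mh h_ge0; pose g := (fun z => h z.1 z.2) \_ (A `*` B).
have mg : measurable_fun setT g.
  by apply/(measurable_restrictT _ _).1 => //; exact: measurableX.
have g_ge0 z : (0 <= g z)%E.
  by rewrite /g patchE; case: ifPn => // /set_mem[Az Bz]; exact: h_ge0.
transitivity (\int[m1]_x \int[m2]_y g (x, y))%E.
  rewrite integral_mkcond; apply: eq_integral => x _; rewrite patchE.
  case: ifPn => [/set_mem Ax|/negP Ax].
    rewrite integral_mkcond; apply: eq_integral => y _; rewrite !patchE.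
    by congr (if _ then _ else _); apply/idP/idP; rewrite !inE//= => -[].
  rewrite integral0_eq// => y _; rewrite /g patchE ifF//.
  by apply/negP => /set_mem[/= /mem_set].
rewrite (@fubini_tonelli _ _ _ _ _ m1 m2 g mg g_ge0).
transitivity (\int[m2]_y \int[m1]_x g (x, y))%E => //.
rewrite [RHS]integral_mkcond; apply: eq_integral => y _; rewrite patchE.
case: ifPn => [/set_mem By|/negP By].
  rewrite [RHS]integral_mkcond; apply: eq_integral => x _; rewrite !patchE.
  by congr (if _ then _ else _); apply/idP/idP; rewrite !inE//= => -[].
rewrite integral0_eq// => x _; rewrite /g patchE ifF//.
by apply/negP => /set_mem[_ /= /mem_set].
Qed.

(** * Euler's integrals *)

Section euler_integrals.
Context {R : realType}.
Implicit Types a b c s t : R.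
Local Notation leb := (@lebesgue_measure R).

(* Extended-real versions, so that Tonelli's theorem applies before finiteness
   is known. In this form of the Beta integral, Tonelli's theorem needs only
   dilations of the half-line. *)
Definition eGamma a : \bar R :=
  (\int[leb]_(t in `]0%R, +oo[) (t `^ (a - 1) * expR (- t))%:E)%E.

Definition eBeta a b : \bar R :=
  (\int[leb]_(t in `]0%R, +oo[) (t `^ (b - 1) * (1 + t) `^ (- (a + b)))%:E)%E.

Lemma exhausts_0y : exhausts (fun n => n.+1%:R^-1) (fun n => n.+2%:R) `]0:R, +oo[.
Proof.
have [aD bI ab U] := @exhausts_oy R 0; split => //.
- by move=> m n mn; have := aD m n mn; rewrite /= !add0r.
- by move=> m n mn; have := bI m n mn; rewrite /= !add0r.
- by move=> n; have := ab n; rewrite /= !add0r.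
- by rewrite -U; apply: eq_bigcupr => n _; rewrite /= !add0r.
Qed.

Lemma itv0yP t : `]0, +oo[%classic t <-> 0 < t.
Proof. by rewrite /= in_itv/= andbT. Qed.

Lemma powRD_gt0 t a b : 0 < t -> t `^ (a + b) = t `^ a * t `^ b.
Proof. by move=> t_gt0; rewrite powRD// (gt_eqF t_gt0) implybT. Qed.

Lemma powRB1 t a : 0 < t -> t `^ (a - 1) = t `^ a / t.
Proof. by move=> t_gt0; rewrite powRD_gt0// powRN powRr1 ?ltW. Qed.

Lemma integral_powR_scaled_exp a c : 0 < c ->
  (\int[leb]_(t in `]0%R, +oo[) (t `^ (a - 1) * expR (- (c * t)))%:E =
   (c `^ (- a))%:E * eGamma a)%E.
Proof.
move=> c_gt0; have c0 : c != 0 by rewrite gt_eqF.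
have -> : eGamma a = (\int[leb]_(t in `]0%R, +oo[)
    ((c * t) `^ (a - 1) * expR (- (c * t)) * c)%:E)%E.
  apply: (@ge0_subst_increasing _ (fun t => c * t) (fun=> c)
    (fun t => t `^ (a - 1) * expR (- t)) _ _ _ _ exhausts_0y).
  - exact: interval_is_interval.
  - apply/seteqP; split=> [_ [t /itv0yP t_gt0 <-]|t /itv0yP t_gt0].
      by apply/itv0yP; rewrite mulr_gt0.
    by exists (t / c); [apply/itv0yP; rewrite divr_gt0|rewrite mulrC divfK].
  - by move=> t _; apply: is_derive_eq; rewrite /GRing.scale/=; ring.
  - by [].
  - by move=> t _; exact: cvg_cst.
  - by move=> t _; rewrite mulr_ge0 ?powR_ge0 ?expR_ge0.
  - by move=> t /itv0yP t_gt0; apply: is_derive_continuous.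
rewrite -ge0_integralZl//=; last 3 first.
- apply/measurable_EFinP; apply: for_continuous_measurable_fun => //.
  move=> t /itv0yP t_gt0; have ct : 0 < c * t by rewrite mulr_gt0.
  by apply: is_derive_continuous.
- by move=> t _; rewrite lee_fin mulr_ge0 ?(ltW c_gt0)// mulr_ge0 ?powR_ge0 ?expR_ge0.
- by rewrite lee_fin powR_ge0.
apply: eq_integral => t /[!inE] /itv0yP t_gt0; rewrite -EFinM; congr EFin.
rewrite powRM ?ltW// (powRB1 _ c_gt0) powRN.
by field; rewrite c0 gt_eqF// powR_gt0.
Qed.

(** Substitution in the integral of 1: the total increase of [F] is the length of its image. It
    evaluates integrals with an explicit antiderivative. *)
Lemma integral_derive_onto01 (F f : R -> R) (p q : nat -> R) (D : set R) :
  exhausts p q D -> F @` D = `]0, 1[%classic ->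
  (forall x, D x -> is_derive x 1 F (f x)) ->
  (forall x, D x -> 0 < f x) ->
  (forall x, D x -> {for x, continuous f}) ->
  (\int[leb]_(x in D) (f x)%:E = 1)%E.
Proof.
move=> exD FD dF f_gt0 cf; transitivity (\int[leb]_(y in `]0%R, 1%R[) 1%:E)%E.
  rewrite (ge0_subst_increasing (f := f) (G := fun=> 1) exD _ FD)//.
  - by apply: eq_integral => x _; rewrite mul1r.
  - exact: interval_is_interval.
  - by move=> y _; exact: cvg_cst.
by rewrite integral_cst//= lebesgue_measure_itv/= lte_fin ltr01 mul1e sube0.
Qed.

Lemma powR1r a : 1 `^ a = 1 :> R.
Proof. by rewrite powR1. Qed.

(** [a] times the integrand is the derivative of (t / (1 + t))^a, which climbs from 0 to 1. *)
Lemma eBeta1r a : 0 < a -> eBeta 1 a = (a^-1)%:E.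
Proof.
move=> a_gt0; have a0 : a != 0 by rewrite gt_eqF.
have : (\int[leb]_(t in `]0%R, +oo[)
    (a * (t `^ (a - 1) * (1 + t) `^ (- (1 + a))))%:E = 1)%E.
  apply: (@integral_derive_onto01 (fun t => (t / (1 + t)) `^ a) _ _ _ _ exhausts_0y).
  - apply/seteqP; split=> [_ [t /itv0yP t_gt0 <-]|y].
      have u_gt0 : 0 < t / (1 + t) by rewrite divr_gt0// addr_gt0.
      rewrite /= in_itv/= powR_gt0//=.
      rewrite -[ltRHS](powR1r a) gt0_ltr_powR// ?nnegrE ?(ltW u_gt0)//.
      by rewrite ltr_pdivrMr ?addr_gt0// mul1r ltrDr.
    rewrite /= in_itv/= => /andP[y_gt0 y_lt1].
    have z_gt0 : 0 < y `^ a^-1 by rewrite powR_gt0.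
    have z_lt1 : y `^ a^-1 < 1.
      rewrite -[ltRHS](powR1r a^-1) gt0_ltr_powR ?invr_gt0// ?nnegrE ?(ltW y_gt0)//.
    have z1 : 1 - y `^ a^-1 != 0 by rewrite subr_eq0 gt_eqF.
    (* The solution t of t / (1 + t) = y^(1/a). *)
    exists (y `^ a^-1 / (1 - y `^ a^-1)).
      by apply/itv0yP; rewrite divr_gt0// subr_gt0.
    have yE : (y `^ a^-1) `^ a = y by rewrite -powRrM mulVf// powRr1 ?ltW.
    rewrite -[RHS]yE; congr (_ `^ _).
    have -> : 1 + y `^ a^-1 / (1 - y `^ a^-1) = (1 - y `^ a^-1)^-1 by field.
    by rewrite invrK divfK.
  - move=> t /itv0yP t_gt0.
    have t1_gt0 : 0 < 1 + t by rewrite addr_gt0.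
    have t1 : 1 + t != 0 by rewrite gt_eqF.
    have u_gt0 : 0 < t / (1 + t) by rewrite divr_gt0.
    apply: is_derive_eq; rewrite /GRing.scale/=.
    rewrite powRM ?invr_ge0 ?ltW// -powR_inv1 ?ltW// -!powRrM.
    have -> : - (1 + a) = -1 * (a - 1) - 1 - 1 by ring.
    rewrite !(powRB1 _ t1_gt0) powR_inv1 ?ltW//.
    by field; rewrite t1.
  - move=> t /itv0yP t_gt0.
    by rewrite !mulr_gt0// powR_gt0// addr_gt0.
  - move=> t /itv0yP t_gt0.
    have t1_gt0 : 0 < 1 + t by rewrite addr_gt0.
    by apply: is_derive_continuous.
under eq_integral do rewrite EFinM.
rewrite ge0_integralZl//=; last 3 first.
- apply/measurable_EFinP; apply: for_continuous_measurable_fun => //.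
  move=> t /itv0yP t_gt0.
  have t1_gt0 : 0 < 1 + t by rewrite addr_gt0.
  by apply: is_derive_continuous.
- by move=> t _; rewrite lee_fin mulr_ge0 ?powR_ge0.
- by rewrite lee_fin ltW.
rewrite -/(eBeta 1 a) => /(congr1 (fun z => (a^-1)%:E * z)%E).
by rewrite muleA -EFinM mulVf// mul1e mule1.
Qed.

Lemma eGamma1 : eGamma 1 = 1%E.
Proof.
rewrite /eGamma; transitivity (\int[leb]_(t in `]0%R, +oo[) (expR (- t))%:E)%E.
  by apply: eq_integral => t _; rewrite subrr powRr0 mul1r.
apply: (@integral_derive_onto01 (fun t => 1 - expR (- t)) _ _ _ _ exhausts_0y).
- apply/seteqP; split=> [_ [t /itv0yP t_gt0 <-]|y].
    rewrite /= in_itv/= subr_gt0 ltrBlDr ltrDl expR_gt0 andbT.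
    by rewrite expR_lt1 oppr_lt0.
  rewrite /= in_itv/= => /andP[y_gt0 y_lt1]; exists (- ln (1 - y)).
    by apply/itv0yP; rewrite oppr_gt0 ln_lt0// subr_gt0 y_lt1 ltrBlDr ltrDl.
  by rewrite opprK lnK ?posrE ?subr_gt0// opprB addrC subrK.
- by move=> t _; apply: is_derive_eq; rewrite /GRing.scale/=; ring.
- by move=> t _; exact: expR_gt0.
- by move=> t _; apply: is_derive_continuous.
Qed.

Lemma measurable_eGamma a (D : set R) : measurable D ->
  measurable_fun D (fun t : R => (t `^ (a - 1) * expR (- t))%:E).
Proof.
move=> mD; apply/measurable_EFinP; apply: measurable_funM.
  by apply: measurable_funTS; exact: measurable_powR.
by apply: measurable_funTS; apply: measurableT_comp => //; exact: measurable_expR.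
Qed.

(** Comparison with [eBeta 1 a], which is 1/a: raising u <= e^u at u = (1 + t)/(1 + a) to the power
    1 + a gives e^(-t) <= C (1 + t)^(-(1 + a)), whence the constant [C]. *)
Lemma eGamma_lty a : 0 < a -> (eGamma a < +oo)%E.
Proof.
move=> a_gt0; pose C := (1 + a) `^ (1 + a) * expR 1.
have a1_gt0 : 0 < 1 + a by rewrite addr_gt0.
have C_ge0 : 0 <= C by rewrite mulr_ge0 ?powR_ge0 ?expR_ge0.
apply: (@le_lt_trans _ _ (C%:E * eBeta 1 a)%E); last first.
  by rewrite eBeta1r// -EFinM ltry.
have mB : measurable_fun (`]0, +oo[%classic : set R)
    (fun t : R => (t `^ (a - 1) * (1 + t) `^ (- (1 + a)))%:E).
  apply/measurable_EFinP; apply: for_continuous_measurable_fun => //.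
  move=> t /itv0yP t_gt0.
  have t1_gt0 : 0 < 1 + t by rewrite addr_gt0.
  by apply: is_derive_continuous.
rewrite -ge0_integralZl//=; last by move=> t _; rewrite lee_fin mulr_ge0 ?powR_ge0.
apply: ge0_le_integral => //=.
- by move=> t _; rewrite lee_fin mulr_ge0 ?powR_ge0 ?expR_ge0.
- exact: measurable_eGamma.
- exact: measurable_funeM.
move=> t /itv0yP t_gt0; rewrite -EFinM lee_fin mulrCA.
rewrite ler_wpM2l ?powR_ge0// powRN expRN ler_pdivlMr ?powR_gt0 ?addr_gt0//.
rewrite mulrC ler_pdivrMr ?expR_gt0// /C -mulrA -expRD.
have u_gt0 : 0 < (1 + t) / (1 + a) by rewrite divr_gt0// addr_gt0.
have -> : (1 + t) `^ (1 + a) = (1 + a) `^ (1 + a) * ((1 + t) / (1 + a)) `^ (1 + a).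
  by rewrite -powRM ?(ltW a1_gt0) ?(ltW u_gt0)// mulrC divfK// gt_eqF.
have -> : expR (1 + t) = expR ((1 + t) / (1 + a)) `^ (1 + a).
  rewrite /powR gt_eqF ?expR_gt0// expRK mulrC divfK// gt_eqF//.
rewrite ler_wpM2l ?powR_ge0// ge0_ler_powR ?nnegrE ?expR_ge0 ?ltW//.
by rewrite (lt_le_trans _ (expR_ge1Dx _))// ltrDr.
Qed.

Lemma eGamma_gt0 a : 0 < a -> (0 < eGamma a)%E.
Proof.
move=> a_gt0.
have sub : `]1, 2[%classic `<=` (`]0, +oo[%classic : set R).
  by move=> t; rewrite /= !in_itv/= => /andP[t1 _]; rewrite (lt_trans _ t1).
(* On (1, 2), t^(a-1) >= 1/t >= 1/2 since a - 1 > -1, and e^(-t) >= e^(-2). *)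
apply: (@lt_le_trans _ _ (\int[leb]_(t in `]1%R, 2%R[) (expR (- 2) / 2)%:E)%E).
  rewrite integral_cst//= lebesgue_measure_itv/= lte_fin ltr1n.
  by rewrite -EFinD -EFinM lte_fin mulr_gt0// ?divr_gt0 ?expR_gt0//; lra.
apply: (@le_trans _ _ (\int[leb]_(t in `]1%R, 2%R[) (t `^ (a - 1) * expR (- t))%:E)%E).
  apply: ge0_le_integral => //=.
    exact: measurable_eGamma.
  move=> t; rewrite in_itv/= => /andP[t_gt1 t_lt2].
  have t_gt0 : 0 < t by rewrite (lt_trans _ t_gt1).
  rewrite lee_fin mulrC ler_pM ?invr_ge0 ?expR_ge0//; last by rewrite ler_expR lerN2 ltW.
  rewrite (@le_trans _ _ (t `^ (-1)))//.
    by rewrite powR_inv1 ?(ltW t_gt0)// lef_pV2 ?posrE// ltW.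
  by apply: (ler_powR (ltW t_gt1)); rewrite lerDr ltW.
apply: ge0_subset_integral => //=.
- exact: measurable_eGamma.
- by move=> t _; rewrite lee_fin mulr_ge0 ?powR_ge0 ?expR_ge0.
Qed.

Lemma EFin_Gamma a : 0 < a -> (Gamma a)%:E = eGamma a.
Proof.
move=> a_gt0; rewrite /Gamma /Rintegral -/(eGamma a) fineK// ge0_fin_numE ?eGamma_lty//.
exact/ltW/eGamma_gt0.
Qed.

Lemma Gamma_gt0 a : 0 < a -> 0 < Gamma a.
Proof. by move=> a_gt0; rewrite -lte_fin EFin_Gamma// eGamma_gt0. Qed.

Lemma Gamma1 : Gamma 1 = 1 :> R.
Proof. by apply: EFin_inj; rewrite EFin_Gamma// eGamma1. Qed.

(** The double integral of [h] is computed in both orders. Integrating over w first gives Gamma(b)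
    s^(a-1) e^(-s), hence the product of the Gamma values; integrating over s first gives Gamma(a+b)
    times the integrand of [eBeta a b]. *)
Lemma eGammaM a b : 0 < a -> 0 < b ->
  (eGamma a * eGamma b = eGamma (a + b) * eBeta a b)%E.
Proof.
move=> a_gt0 b_gt0; have ab_gt0 : 0 < a + b by rewrite addr_gt0.
have fin c : 0 < c -> eGamma c = (Gamma c)%:E by move=> ?; rewrite EFin_Gamma.
pose h s w : \bar R := (s `^ (a + b - 1) * expR (- ((1 + w) * s)) * w `^ (b - 1))%:E.
transitivity (\int[leb]_(s in `]0%R, +oo[) \int[leb]_(w in `]0%R, +oo[) h s w)%E.
  transitivity (\int[leb]_(s in `]0%R, +oo[)
      ((s `^ (a - 1) * expR (- s))%:E * (Gamma b)%:E))%E.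
    rewrite ge0_integralZr//=.
    - by rewrite -/(eGamma a) (fin b).
    - exact: measurable_eGamma.
    - by move=> t _; rewrite lee_fin mulr_ge0 ?powR_ge0 ?expR_ge0.
    - by rewrite lee_fin ltW// Gamma_gt0.
  apply: eq_integral => s /[!inE] /itv0yP s_gt0.
  transitivity (\int[leb]_(w in `]0%R, +oo[)
    ((s `^ (a + b - 1) * expR (- s))%:E * (w `^ (b - 1) * expR (- (s * w)))%:E))%E.
    rewrite ge0_integralZl//=.
    - rewrite integral_powR_scaled_exp// (fin b)// -!EFinM; congr EFin.
      rewrite !powRB1// powRD_gt0// powRN.
      by field; rewrite !gt_eqF// powR_gt0.
    - apply/measurable_EFinP; apply: for_continuous_measurable_fun => //.
      by move=> t /itv0yP t_gt0; apply: is_derive_continuous.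
    - by move=> t _; rewrite lee_fin mulr_ge0 ?powR_ge0 ?expR_ge0.
    - by rewrite lee_fin mulr_ge0 ?powR_ge0 ?expR_ge0.
  apply: eq_integral => w _; rewrite /h -EFinM; congr EFin.
  have -> : - ((1 + w) * s) = - s + - (s * w) by ring.
  by rewrite expRD; ring.
rewrite fubini_tonelli_setX//; last 2 first.
- apply/measurable_EFinP; apply: measurable_funTS.
  apply: measurable_funM; first apply: measurable_funM.
  + by apply: (measurableT_comp (measurable_powR _)).
  + apply: measurableT_comp => //; apply: measurableT_comp => //.
    by apply: measurable_funM => //; exact: measurable_funD.
  + by apply: (measurableT_comp (measurable_powR _)).
- by move=> s w _ _; rewrite lee_fin !mulr_ge0 ?powR_ge0 ?expR_ge0.
transitivity (\int[leb]_(w in `]0%R, +oo[)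
    ((Gamma (a + b))%:E * (w `^ (b - 1) * (1 + w) `^ (- (a + b)))%:E))%E; last first.
  rewrite ge0_integralZl//=.
  - by rewrite -/(eBeta a b) (fin (a + b)).
  - apply/measurable_EFinP; apply: for_continuous_measurable_fun => //.
    move=> t /itv0yP t_gt0.
    have t1_gt0 : 0 < 1 + t by rewrite addr_gt0.
    by apply: is_derive_continuous.
  - by move=> t _; rewrite lee_fin mulr_ge0 ?powR_ge0.
  - by rewrite lee_fin ltW// Gamma_gt0.
apply: eq_integral => w /[!inE] /itv0yP w_gt0.
have w1_gt0 : 0 < 1 + w by rewrite addr_gt0.
under eq_integral do rewrite /h EFinM muleC.
rewrite ge0_integralZl//=.
- rewrite (integral_powR_scaled_exp _ w1_gt0) (fin (a + b))// -!EFinM.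
  by congr EFin; ring.
- apply/measurable_EFinP; apply: for_continuous_measurable_fun => //.
  by move=> t /itv0yP t_gt0; apply: is_derive_continuous.
- by move=> t _; rewrite lee_fin mulr_ge0 ?powR_ge0 ?expR_ge0.
- by rewrite lee_fin powR_ge0.
Qed.

Lemma eBetaE a b : 0 < a -> 0 < b -> eBeta a b = (Beta a b)%:E.
Proof.
move=> a_gt0 b_gt0; have ab_gt0 : 0 < a + b by rewrite addr_gt0.
have := eGammaM a_gt0 b_gt0; rewrite -!EFin_Gamma// /Beta => E.
have G0 : Gamma (a + b) != 0 by rewrite gt_eqF// Gamma_gt0.
by rewrite mulrC EFinM [(_ * _)%:E]EFinM E muleA -EFinM mulVf// mul1e.
Qed.

(** Read off from B(1,a) = 1/a and Gamma(1) = 1, without integration by parts. *)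
Lemma GammaD1 a : 0 < a -> Gamma (a + 1) = a * Gamma a.
Proof.
move=> a_gt0; have := eBetaE ltr01 a_gt0; rewrite eBeta1r// => -[].
rewrite /Beta Gamma1 mul1r addrC => E.
have G0 : Gamma a != 0 by rewrite gt_eqF// Gamma_gt0.
have G1 : Gamma (a + 1) != 0 by rewrite gt_eqF// Gamma_gt0// addr_gt0.
have a0 : a != 0 by rewrite gt_eqF.
by apply: (mulIf (invr_neq0 G1)); rewrite mulfV// -mulrA -E mulfV.
Qed.

(** * Beta integrals over (-1, 1) and (0, 1), and the duplication formula *)

Lemma powRV a t : 0 < t -> t^-1 `^ a = (t `^ a)^-1.
Proof. by move=> t_gt0; rewrite -powR_inv1 ?ltW// -powRrM mulN1r powRN. Qed.

Lemma powR_div a s t : 0 < s -> 0 < t -> (s / t) `^ a = s `^ a / t `^ a.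
Proof. by move=> s0 t0; rewrite powRM ?invr_ge0 ?ltW// powRV. Qed.

Lemma ge0_integral_fold (c : R) (h : R -> R) : 0 < c ->
  measurable_fun `]- c, c[ h ->
  (forall t, t \in `]- c, c[ -> 0 <= h t) ->
  (\int[leb]_(t in `](- c)%R, c[) (h t)%:E =
   \int[leb]_(t in `]0%R, c[) (h t + h (- t))%:E)%E.
Proof.
move=> c_gt0 mh h_ge0.
have cV : `]- c, c[%classic = `]- c, 0] `|` `]0, c[ :> set R.
  apply/seteqP; split=> t; rewrite /= !in_itv/=.
    by case/andP=> -> ->; case: leP => _; [left|right].
  case=> /andP[t1 t2]; apply/andP; split=> //.
    by rewrite (le_lt_trans t2).
  by rewrite (lt_trans _ t1)// oppr_lt0.
have subl : `]- c, 0]%classic `<=` (`]- c, c[%classic : set R) by rewrite cV; left.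
have subr : `]0, c[%classic `<=` (`]- c, c[%classic : set R) by rewrite cV; right.
have mhN : measurable_fun (`]0, c[%classic : set R) (fun t => h (- t)).
  apply: (measurable_comp (measurable_itv `]- c, c[)) => //.
    by move=> _ /= [t + <-]; rewrite !in_itv/=; lra.
have h_ge0r t : `]0, c[%classic t -> 0 <= h t by move=> /subr/h_ge0.
have hN_ge0r t : `]0, c[%classic t -> 0 <= h (- t).
  by move=> tc; apply: h_ge0; move: tc; rewrite /= !in_itv/=; lra.
rewrite cV ge0_integral_setU//=; last 3 first.
- by apply/measurable_EFinP; move: mh; rewrite cV.
- by move=> t tc; rewrite lee_fin h_ge0//; have : `]- c, c[%classic t by rewrite cV.
- apply/disj_setPS => t [/=]; rewrite !in_itv/= => /andP[_ t_le0] /andP[t_gt0 _].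
  by move: t_le0; rewrite leNgt t_gt0.
under [RHS]eq_integral do rewrite EFinD.
rewrite ge0_integralD//=; last 2 first.
- by apply/measurable_EFinP; exact: measurable_funS mh.
- exact/measurable_EFinP.
rewrite addeC; congr (_ + _)%E.
rewrite -integral_itv_bndo_bndc; last first.
  apply/measurable_EFinP; apply: measurable_funS mh => //.
  by apply: subset_trans subl; exact: subset_itvW.
(* The reflection used next exchanges half-lines, hence the extension by zero. *)
pose f := (fun t => (h (- t))%:E) \_ (`]0, c[%classic : set R).
have mf : measurable_fun setT f.
  by apply/(measurable_restrictT _ _).1 => //; exact/measurable_EFinP.
have f_ge0 t : (0 <= f t)%E.
  by rewrite /f patchE; case: ifPn => // /set_mem tc; rewrite lee_fin hN_ge0r.
have := ge0_integration_by_substitution0 mf f_ge0.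
rewrite /f -integral_mkcondr setIidr; last first.
  by move=> t; rewrite /= !in_itv/= => /andP[/ltW -> _].
move=> ->.
transitivity (\int[leb]_(t in `]-oo, 0%R])
   ((fun t => (h t)%:E) \_ (`](- c)%R, 0%R[%classic : set R)) t)%E.
  rewrite -integral_mkcondr setIidr//.
  by move=> t; rewrite /= !in_itv/= => /andP[_ /ltW].
apply: eq_integral => t _; rewrite !patchE opprK.
congr (if _ then _ else _); apply/idP/idP; rewrite !inE/= !in_itv/=; lra.
Qed.

(** The substitution w = (1 + t)/(1 - t) maps (-1, 1) onto the half-line; 1 + w = 2/(1 - t) is the
    source of the power of 2. *)
Lemma integral_sqr_beta s : 0 < s ->
  (\int[leb]_(t in `](-1)%R, 1%R[) ((1 - t ^+ 2) `^ (s - 1))%:E =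
   (2 `^ (s + s) / 2 * Beta s s)%:E)%E.
Proof.
move=> s_gt0.
have tb t : `]-1, 1[%classic t -> 0 < 1 + t /\ 0 < 1 - t.
  by rewrite /= in_itv/=; lra.
have /= E : eBeta s s = (\int[leb]_(t in `](-1)%R, 1%R[)
   ((((1 + t) / (1 - t)) `^ (s - 1) * (1 + (1 + t) / (1 - t)) `^ (- (s + s)))
     * (2 * (1 - t) ^- 2))%:E)%E.
  apply: (@ge0_subst_increasing _ (fun t => (1 + t) / (1 - t))
    (fun t => 2 * (1 - t) ^- 2)
    (fun w => w `^ (s - 1) * (1 + w) `^ (- (s + s))) _ _ _ _
    (@exhausts_oo R (-1) 1 _)).
  - by lra.
  - exact: interval_is_interval.
  - apply/seteqP; split=> [_ [t /tb[p_gt0 q_gt0] <-]|w /itv0yP w_gt0].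
      by apply/itv0yP; rewrite divr_gt0.
    have w1_gt0 : 0 < w + 1 by rewrite addr_gt0.
    exists ((w - 1) / (w + 1)).
      rewrite /= in_itv/= ltr_pdivlMr// ltr_pdivrMr//; lra.
    rewrite /=; have -> : 1 + (w - 1) / (w + 1) = 2 * w / (w + 1).
      by field; rewrite gt_eqF.
    have -> : 1 - (w - 1) / (w + 1) = 2 / (w + 1) by field; rewrite gt_eqF.
    by field; rewrite gt_eqF.
  - move=> t /tb[p_gt0 q_gt0]; have q0 : 1 - t != 0 by rewrite gt_eqF.
    by apply: is_derive_eq; rewrite /GRing.scale/=; field.
  - by move=> t /tb[p_gt0 q_gt0]; rewrite mulr_gt0// invr_gt0 exprn_gt0.
  - move=> t /tb[p_gt0 q_gt0]; have q0 : (1 - t) ^+ 2 != 0.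
      by rewrite gt_eqF// exprn_gt0.
    by apply: is_derive_continuous.
  - by move=> w _; rewrite mulr_ge0 ?powR_ge0.
  - move=> w /itv0yP w_gt0; have w1_gt0 : 0 < 1 + w by rewrite addr_gt0.
    by apply: is_derive_continuous.
rewrite EFinM -eBetaE// E -ge0_integralZl//=; last 2 first.
- apply/measurable_EFinP; apply: for_continuous_measurable_fun => //.
  move=> t /tb[p_gt0 q_gt0]; have q0 : 1 - t != 0 by rewrite gt_eqF.
  have u_gt0 : 0 < (1 + t) / (1 - t) by rewrite divr_gt0.
  have u1_gt0 : 0 < 1 + (1 + t) / (1 - t) by rewrite addr_gt0.
  have q20 : (1 - t) ^+ 2 != 0 by rewrite gt_eqF// exprn_gt0.
  by apply: is_derive_continuous.
- move=> t /tb[p_gt0 q_gt0]; rewrite lee_fin !mulr_ge0 ?powR_ge0//.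
  by rewrite invr_ge0 exprn_ge0 ?ltW.
apply: eq_integral => t /[!inE] /tb[p_gt0 q_gt0]; rewrite -EFinM; congr EFin.
have q0 : 1 - t != 0 by rewrite gt_eqF.
have -> : 1 - t ^+ 2 = (1 + t) * (1 - t) by ring.
have -> : 1 + (1 + t) / (1 - t) = 2 / (1 - t) by field.
rewrite !powR_div// powRM ?(ltW p_gt0) ?(ltW q_gt0)//.
rewrite !powRN !powRB1// !powRD_gt0//.
by field; rewrite q0 !gt_eqF ?powR_gt0.
Qed.

(** The substitution is w = t^2/(1 - t^2), for which 1 + w = 1/(1 - t^2). At b = k + 1/2 the power
    of t is t^(2k), as in the even terms of the exponential series. *)
Lemma integral_half_beta a b : 0 < a -> 0 < b ->
  (\int[leb]_(t in `]0%R, 1%R[) (2 * t `^ (b + b - 1) * (1 - t ^+ 2) `^ (a - 1))%:E =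
   (Beta a b)%:E)%E.
Proof.
move=> a_gt0 b_gt0.
have tb t : `]0, 1[%classic t -> 0 < t /\ 0 < 1 - t ^+ 2.
  rewrite /= in_itv/= => /andP[t_gt0 t_lt1]; split=> //.
  by rewrite subr_gt0 expr_lt1// ltW.
have /= E : eBeta a b = (\int[leb]_(t in `]0%R, 1%R[)
   (((t ^+ 2 / (1 - t ^+ 2)) `^ (b - 1) *
     (1 + t ^+ 2 / (1 - t ^+ 2)) `^ (- (a + b)))
     * (2 * t * (1 - t ^+ 2) ^- 2))%:E)%E.
  apply: (@ge0_subst_increasing _ (fun t => t ^+ 2 / (1 - t ^+ 2))
    (fun t => 2 * t * (1 - t ^+ 2) ^- 2)
    (fun w => w `^ (b - 1) * (1 + w) `^ (- (a + b))) _ _ _ _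
    (@exhausts_oo R 0 1 ltr01)).
  - exact: interval_is_interval.
  - apply/seteqP; split=> [_ [t /tb[p_gt0 q_gt0] <-]|w /itv0yP w_gt0].
      by apply/itv0yP; rewrite divr_gt0// exprn_gt0.
    have w1_gt0 : 0 < w + 1 by rewrite addr_gt0.
    have u_gt0 : 0 < w / (w + 1) by rewrite divr_gt0.
    exists (Num.sqrt (w / (w + 1))).
      rewrite /= in_itv/= sqrtr_gt0 u_gt0/= -[ltRHS]sqrtr1 ltr_sqrt// ltr_pdivrMr//; lra.
    rewrite /= sqr_sqrtr ?ltW//.
    have -> : 1 - w / (w + 1) = (w + 1)^-1 by field; rewrite gt_eqF.
    by field; rewrite gt_eqF.
  - move=> t /tb[p_gt0 q_gt0]; have q0 : 1 - t ^+ 2 != 0 by rewrite gt_eqF.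
    by apply: is_derive_eq; rewrite /GRing.scale/=; field.
  - by move=> t /tb[p_gt0 q_gt0]; rewrite !mulr_gt0// invr_gt0 exprn_gt0.
  - move=> t /tb[p_gt0 q_gt0]; have q0 : (1 - t ^+ 2) ^+ 2 != 0.
      by rewrite gt_eqF// exprn_gt0.
    by apply: is_derive_continuous.
  - by move=> w _; rewrite mulr_ge0 ?powR_ge0.
  - move=> w /itv0yP w_gt0; have w1_gt0 : 0 < 1 + w by rewrite addr_gt0.
    by apply: is_derive_continuous.
rewrite -(eBetaE a_gt0 b_gt0) E.
apply: eq_integral => t /[!inE] /tb[p_gt0 q_gt0]; congr EFin.
have q0 : 1 - t ^+ 2 != 0 by rewrite gt_eqF.
have t2_gt0 : 0 < t ^+ 2 by rewrite exprn_gt0.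
have -> : 1 + t ^+ 2 / (1 - t ^+ 2) = (1 - t ^+ 2)^-1 by field.
rewrite powR_div// powRV//.
have t2E : (t ^+ 2) `^ b = t `^ b * t `^ b.
  by rewrite expr2 powRM ?ltW.
rewrite !powRN !powRB1// !powRD_gt0// t2E.
by field; rewrite q0 !gt_eqF ?powR_gt0.
Qed.

(** Both sides evaluate the integral of (1 - t^2)^(s-1) over (-1, 1): directly, and folded onto (0,
    1), where b = 1/2 makes the power of t trivial. *)
Lemma Beta_duplication s : 0 < s -> 2 `^ (s + s) / 2 * Beta s s = Beta s 2^-1.
Proof.
move=> s_gt0; apply: EFin_inj; rewrite -integral_sqr_beta//.
have ms : measurable_fun (`]-1, 1[%classic : set R) (fun t => (1 - t ^+ 2) `^ (s - 1)).
  apply: measurable_funTS; apply: (measurableT_comp (measurable_powR _)).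
  by apply: measurable_funB => //; exact: exprn_measurable.
rewrite ge0_integral_fold//; last by move=> t _; exact: powR_ge0.
have half_gt0 : 0 < 2^-1 :> R by rewrite invr_gt0.
rewrite -(integral_half_beta s_gt0 half_gt0); apply: eq_integral => t /[!inE] /=.
rewrite in_itv/= => /andP[t_gt0 _]; congr EFin.
rewrite sqrrN (_ : 2^-1 + 2^-1 - 1 = 0) ?powRr0; [ring|by field].
Qed.

End euler_integrals.

(** * Differentiation of a Mellin transform *)

#[local] Instance is_derive1_powRr {R : realType} (a : R) (g : R -> R) (x dg : R) :
  0 < a -> is_derive x 1 g dg ->
  is_derive x 1 (fun r => a `^ g r) (a `^ g x * ln a * dg).
Proof.
move=> a_gt0 dgx.
have -> : (fun r => a `^ g r) = (fun r => expR (g r * ln a)).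
  by apply/funext => r; rewrite /powR gt_eqF.
by apply: is_derive_eq; rewrite /powR gt_eqF// /GRing.scale/=; ring.
Qed.

Section mellin.
Context {R : realType} d {T : measurableType d}.
Variables (mu : {measure set T -> \bar R}) (D : set T) (v w : T -> R).
Hypotheses (mD : measurable D) (v_gt0 : forall y, D y -> 0 < v y).
Hypothesis w_ge0 : forall y, 0 <= w y.
Hypothesis mvw : forall s : R, 0 < s ->
  mu.-integrable D (fun y => (v y `^ (s - 1) * w y)%:E).

(** Both cases are ln y < y, at y = a for a >= 1 and at y = a^(-e) for a < 1. *)
Lemma norm_ln_le (a e : R) : 0 < a -> 0 < e -> `|ln a| <= e^-1 * a `^ (- e) + a.
Proof.
move=> a_gt0 e_gt0; have [a1|a1] := leP 1 a.
  rewrite ger0_norm ?ln_ge0// (le_trans (ltW (ln_sublinear a_gt0)))//.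
  by rewrite lerDr mulr_ge0 ?powR_ge0// invr_ge0 ltW.
rewrite ltr0_norm ?ln_lt0 ?a_gt0// ler_wpDr ?(ltW a_gt0)//.
rewrite ler_pdivlMl// mulrN -mulNr -ln_powR.
exact/ltW/ln_sublinear/powR_gt0.
Qed.

(* For s/2 < r < s+1, |v^(r-1) ln v| is at most
   (v^(s/2-1) + v^s) (4/s v^(-s/4) + v). *)
Let bound (s : R) y :=
  4 / s * (v y `^ (s / 4 - 1) * w y) + v y `^ (s / 2 + 1 - 1) * w y +
  4 / s * (v y `^ (3 * s / 4 + 1 - 1) * w y) + v y `^ (s + 2 - 1) * w y.

(** Each term is a multiple of v^(r-1) w, with r = s/4, s/2 + 1, 3s/4 + 1 or s + 2. Taking e = s/4,
    less than s/2, for the logarithm keeps the least of these positive. *)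
Let bound_integrable (s : R) : 0 < s -> mu.-integrable D (EFin \o bound s).
Proof.
move=> s_gt0; rewrite /bound.
have mvwZ c r : 0 < r -> mu.-integrable D (fun y => (c * (v y `^ (r - 1) * w y))%:E).
  move=> r_gt0; under eq_fun do rewrite EFinM.
  by apply: integrableZl => //; exact: mvw.
rewrite [EFin \o _](_ : _ = fun y => (
  (4 / s * (v y `^ (s / 4 - 1) * w y))%:E + (v y `^ (s / 2 + 1 - 1) * w y)%:E +
  (4 / s * (v y `^ (3 * s / 4 + 1 - 1) * w y))%:E + (v y `^ (s + 2 - 1) * w y)%:E)%E);
  last by apply/funext => y; rewrite /= !EFinD.
apply: integrableD => //; first apply: integrableD => //; first apply: integrableD => //.
- by apply: mvwZ; lra.
- by apply: mvw; lra.
- by apply: mvwZ; lra.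
- by apply: mvw; lra.
Qed.

Let bound_ge0 (s : R) y : 0 < s -> 0 <= bound s y.
Proof.
by move=> /ltW s_ge0; rewrite /bound !addr_ge0 ?mulr_ge0 ?w_ge0 ?powR_ge0 ?invr_ge0.
Qed.

Let bound_ln (s r : R) y : 0 < s -> r \in `](s / 2), (s + 1)[ -> D y ->
  `|v y `^ (r - 1) * ln (v y) * w y| <= bound s y.
Proof.
rewrite in_itv/= => s_gt0 /andP[sr rs] Dy; have a_gt0 := v_gt0 Dy.
rewrite normrM (ger0_norm (w_ge0 y)) normrM (ger0_norm (powR_ge0 _ _)).
have s4 : 0 < s / 4 by lra.
(* The larger end of the range of exponents dominates when v >= 1, the smaller one when v < 1; the
   sum covers both. *)
have le_pow : v y `^ (r - 1) <= v y `^ (s / 2 - 1) + v y `^ (s + 1 - 1).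
  have [a1|a1] := leP 1 (v y).
    apply: (@le_trans _ _ (v y `^ (s + 1 - 1))); last by rewrite lerDr powR_ge0.
    by apply: (ler_powR a1); lra.
  apply: (@le_trans _ _ (v y `^ (s / 2 - 1))); last by rewrite lerDl powR_ge0.
  by apply: ger_powR; [rewrite a_gt0 ltW|lra].
have := ler_pM (powR_ge0 _ _) (normr_ge0 _) le_pow (norm_ln_le a_gt0 s4).
move=> /(ler_wpM2r (w_ge0 y)) /le_trans; apply.
rewrite /bound le_eqVlt; apply/orP; left; apply/eqP.
have E1 : v y `^ (s / 4 - 1) = v y `^ (s / 2 - 1) * v y `^ (- (s / 4)).
  by rewrite -powRD_gt0//; congr (_ `^ _); field.
have E2 : v y `^ (3 * s / 4 + 1 - 1) = v y `^ (s + 1 - 1) * v y `^ (- (s / 4)).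
  by rewrite -powRD_gt0//; congr (_ `^ _); field.
have E3 : v y `^ (s / 2 + 1 - 1) = v y `^ (s / 2 - 1) * v y.
  by rewrite -[X in _ = _ * X](powRr1 (ltW a_gt0)) -powRD_gt0//; congr (_ `^ _); field.
have E4 : v y `^ (s + 2 - 1) = v y `^ (s + 1 - 1) * v y.
  by rewrite -[X in _ = _ * X](powRr1 (ltW a_gt0)) -powRD_gt0//; congr (_ `^ _); ring.
rewrite E1 E2 E3 E4 invf_div; ring.
Qed.

Let F (s : R) := \int[mu]_(y in D) (v y `^ (s - 1) * w y).

Let f (s : R) y := v y `^ (s - 1) * w y.

Let der_f (s : R) y : D y -> is_derive s 1 (f ^~ y) (v y `^ (s - 1) * ln (v y) * w y).
Proof.
move=> Dy; have vy_gt0 := v_gt0 Dy.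
by rewrite /f; apply: is_derive_eq; rewrite /GRing.scale/=; ring.
Qed.

(** The window (s/2, s + 1) contains s, keeps to positive exponents, and [bound s] dominates the
    derivative uniformly on it. Gamma is the case v(t) = t, w(t) = e^(-t); J is the case v(t) = 1 -
    t^2, w(t) = e^(ct). *)
Lemma is_derive_mellin (s : R) : 0 < s ->
  is_derive s 1 F (\int[mu]_(y in D) (v y `^ (s - 1) * ln (v y) * w y)).
Proof.
move=> s_gt0.
have I s' : s' \in `](s / 2), (s + 1)[ -> 0 < s' by rewrite in_itv/=; lra.
have sI : `](s / 2), (s + 1)[%classic s by rewrite /= in_itv/=; lra.
have p1 s' y : D y -> partial1of2 f s' y = v y `^ (s' - 1) * ln (v y) * w y.
  by move=> Dy; have := der_f s' Dy => ?; rewrite partial1of2E derive_val.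
have intf s' : `](s / 2), (s + 1)[%classic s' -> mu.-integrable D (EFin \o f s').
  by move=> /I; exact: mvw.
have derf s' y : `](s / 2), (s + 1)[%classic s' -> D y -> derivable (f ^~ y) s' 1.
  by move=> _ Dy; exact: (@ex_derive _ _ _ _ _ _ _ (der_f s' Dy)).
have bnd s' y : `](s / 2), (s + 1)[%classic s' -> D y ->
    `|partial1of2 f s' y| <= bound s y.
  by move=> s'I Dy; rewrite p1//; exact: bound_ln.
have b0 y : 0 <= bound s y by exact: bound_ge0.
apply: DeriveDef.
  exact: (derivable_under_integral mD sI intf derf b0 (bound_integrable s_gt0) bnd).
rewrite -derive1E.
rewrite (differentiation_under_integral mD sI intf derf b0 (bound_integrable s_gt0) bnd).
by apply: eq_Rintegral => y /[!inE] Dy; exact: p1.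
Qed.

Lemma integrable_mellin_ln (s : R) : 0 < s -> measurable_fun D v -> measurable_fun D w ->
  mu.-integrable D (fun y => (v y `^ (s - 1) * ln (v y) * w y)%:E).
Proof.
move=> s_gt0 mv mw; apply: (le_integrable mD _ _ (bound_integrable s_gt0)).
  apply/measurable_EFinP; apply: measurable_funM => //; apply: measurable_funM.
    exact: (measurableT_comp (measurable_powR _) mv).
  exact: (measurableT_comp (@measurable_ln R) mv).
move=> y Dy; rewrite /= lee_fin (ger0_norm (bound_ge0 _ _))//.
by apply: bound_ln => //; rewrite in_itv/=; lra.
Qed.

End mellin.

(** * Poisson's integral *)

Section poisson.
Context {R : realType}.
Implicit Types a b c s t y : R.
Local Notation leb := (@lebesgue_measure R).

Lemma derivable_Gamma a : 0 < a -> derivable (@Gamma R) a 1.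
Proof.
move=> a_gt0.
have D_gt0 t : `]0, +oo[%classic t -> 0 < t by move/itv0yP.
have int s : 0 < s ->
    leb.-integrable `]0, +oo[ (fun t => (t `^ (s - 1) * expR (- t))%:E).
  move=> s_gt0; apply/integrableP; split; first exact: measurable_eGamma.
  under eq_integral => t _ do
    rewrite abse_EFin ger0_norm ?mulr_ge0 ?powR_ge0 ?expR_ge0//.
  exact: eGamma_lty.
have := @is_derive_mellin R _ _ leb _ id (fun t => expR (- t))
  (measurable_itv _) D_gt0 (fun t => expR_ge0 (- t)) int a a_gt0.
by move=> dG; exact: (@ex_derive _ _ _ _ _ _ _ dG).
Qed.

(** In this form (2k)! cancels the factorial of the exponential series, leaving the k! of the Bessel
    series. *)
Lemma Gamma_half k : Gamma (k%:R + 2^-1) =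
  Gamma 2^-1 * (2 * k)`!%:R / (4 ^+ k * k`!%:R) :> R.
Proof.
elim: k => [|k IH]; first by rewrite add0r muln0 !fact0 expr0 !mulr1 divr1.
have -> : k.+1%:R + 2^-1 = k%:R + 2^-1 + 1 :> R by rewrite -natr1; ring.
have h_gt0 : 0 < k%:R + 2^-1 :> R by rewrite ltr_wpDl// invr_gt0.
rewrite GammaD1// IH mulnS !factS !natrM exprS.
have k0 : k`!%:R != 0 :> R by rewrite pnatr_eq0 -lt0n fact_gt0.
have k1 : k.+1%:R != 0 :> R by rewrite pnatr_eq0.
rewrite -!natr1 in k1 *; rewrite natrM.
by field; rewrite k0 k1 expf_neq0// pnatr_eq0.
Qed.

Lemma cosh_series y :
  (\sum_(k <oo) (2 * y ^+ (2 * k) / (2 * k)`!%:R)%:E = (expR y + expR (- y))%:E)%E.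
Proof.
apply/cvg_lim => //; under eq_fun do rewrite sumEFin.
apply: cvg_EFin; first exact: nearW.
(* Partial sums of length 2n contain odd terms in cancelling pairs, and the exponential series
   converges along this subsequence. *)
have even n : \sum_(0 <= k < n) (2 * y ^+ (2 * k) / (2 * k)`!%:R) =
    series (exp_coeff y) (2 * n)%N + series (exp_coeff (- y)) (2 * n)%N.
  rewrite /series/=; elim: n => [|n IH]; first by rewrite !big_geq// addr0.
  rewrite big_nat_recr//= IH mulnS !big_nat_recr//= /exp_coeff/=.
  rewrite exprS [(- y) ^+ _.+1]exprS !exprM sqrrN.
  by rewrite mul2n; ring.
rewrite /comp/=; under eq_fun do rewrite even.
have cvg2 (z : R) : series (exp_coeff z) (2 * n)%N @[n --> \oo] --> expR z.
  apply: (cvg_comp (fun n => 2 * n)%N (series (exp_coeff z))); last first.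
    exact: is_cvg_series_exp_coeff.
  apply/cvgnyPge => N; near=> n; rewrite (@leq_trans n)//.
    by near: n; exact: nbhs_infty_ge.
  by rewrite leq_pmull.
exact: (@cvgD _ R^o _ _ _ _ _ _ _ (cvg2 y) (cvg2 (- y))).
Unshelve. all: by end_near. Qed.

(** J(s) with c = x/2. Either sign of [c] is allowed, as only c^2 enters the expansion; this is how
    |x| arises. *)
Definition poisson_integral c s : R :=
  \int[leb]_(t in `]-1, 1[) ((1 - t ^+ 2) `^ (s - 1) * expR (c * t)).

Lemma measurable_weight s (D : set R) :
  measurable_fun D (fun t => (1 - t ^+ 2) `^ (s - 1)).
Proof.
apply: measurable_funTS; apply: (measurableT_comp (measurable_powR _)).
by apply: measurable_funB => //; exact: exprn_measurable.
Qed.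

Lemma measurable_expM c (D : set R) : measurable_fun D (fun t => expR (c * t)).
Proof.
by apply: measurable_funTS; apply: measurableT_comp.
Qed.

Lemma one_sub_sqr_gt0 t : `]-1, 1[%classic t -> 0 < 1 - t ^+ 2.
Proof.
rewrite /= in_itv/= -ltr_norml => t1.
by rewrite subr_gt0 -real_normK ?num_real// expr_lt1.
Qed.

Lemma integrable_poisson c s : 0 < s ->
  leb.-integrable `]-1, 1[ (fun t => ((1 - t ^+ 2) `^ (s - 1) * expR (c * t))%:E).
Proof.
move=> s_gt0.
have iw : leb.-integrable `]-1, 1[
    (fun t => (expR `|c|)%:E * ((1 - t ^+ 2) `^ (s - 1))%:E)%E.
  apply: integrableZl => //; apply/integrableP; split.
    by apply/measurable_EFinP; exact: measurable_weight.
  under eq_integral => t _ do rewrite abse_EFin ger0_norm ?powR_ge0//.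
  by rewrite integral_sqr_beta// ltry.
apply: (le_integrable _ _ _ iw) => //.
  apply/measurable_EFinP; apply: measurable_funM; first exact: measurable_weight.
  exact: measurable_expM.
move=> t; rewrite /= in_itv/= => /andP[t1 t2].
rewrite lee_fin !normrM mulrC !(ger0_norm (powR_ge0 _ _)) !(ger0_norm (expR_ge0 _)).
rewrite ler_wpM2r ?powR_ge0// ler_expR (le_trans (ler_norm _))// normrM.
by rewrite ler_piMr// ler_norml; apply/andP; split; lra.
Qed.

(** Folding onto (0, 1) comes before expanding: e^(ct) + e^(-ct) has a series of nonnegative terms
    for either sign of c, so sum and integral are exchanged by monotone convergence. *)
Lemma poisson_series c s : 0 < s ->
  series (fun k => c ^+ (2 * k) / (2 * k)`!%:R * Beta s (k%:R + 2^-1)) @ \oo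
    --> poisson_integral c s.
Proof.
move=> s_gt0; set u := (fun k => _).
have even_ge0 (z : R) k : 0 <= z ^+ (2 * k) by rewrite exprM exprn_ge0// sqr_ge0.
have u_ge0 k : 0 <= u k.
  apply: mulr_ge0; first by rewrite divr_ge0.
  have k_gt0 : 0 < k%:R + 2^-1 :> R by rewrite ltr_wpDl// invr_gt0.
  have G_ge0 a : 0 < a -> 0 <= Gamma a by move=> ?; exact/ltW/Gamma_gt0.
  by rewrite divr_ge0 ?mulr_ge0 ?G_ge0// addr_gt0.
have sumE : (\sum_(k <oo) (u k)%:E = (poisson_integral c s)%:E)%E.
  rewrite /poisson_integral /Rintegral fineK; last first.
    exact: integrable_fin_num (integrable_poisson c s_gt0).
  rewrite ge0_integral_fold//; last 2 first.
  - by apply: measurable_funM; [exact: measurable_weight|exact: measurable_expM].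
  - by move=> t _; rewrite mulr_ge0 ?powR_ge0 ?expR_ge0.
  transitivity (\int[leb]_(t in `]0%R, 1%R[) \sum_(k <oo)
      ((c ^+ (2 * k) / (2 * k)`!%:R)%:E *
        (2 * t `^ (k%:R + 2^-1 + (k%:R + 2^-1) - 1) * (1 - t ^+ 2) `^ (s - 1))%:E))%E.
    rewrite integral_nneseries//=; last 2 first.
    + move=> k; apply: measurable_funeM; apply/measurable_EFinP.
      apply: measurable_funM; last exact: measurable_weight.
      apply: measurable_funM => //; apply: measurable_funTS; exact: measurable_powR.
    + move=> k t _; apply: mule_ge0; rewrite lee_fin.
        by rewrite divr_ge0.
      by rewrite !mulr_ge0 ?powR_ge0.
    apply: eq_eseriesr => k _; rewrite ge0_integralZl//=; last 3 first.
    + apply/measurable_EFinP.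
      apply: measurable_funM; last exact: measurable_weight.
      apply: measurable_funM => //; apply: measurable_funTS; exact: measurable_powR.
    + by move=> t _; rewrite lee_fin !mulr_ge0 ?powR_ge0.
    + by rewrite lee_fin divr_ge0.
    have k_gt0 : 0 < k%:R + 2^-1 :> R by rewrite ltr_wpDl// invr_gt0.
    by rewrite (integral_half_beta s_gt0 k_gt0).
  apply: eq_integral => t /[!inE]; rewrite /= in_itv/= => /andP[t_gt0 t_lt1].
  transitivity (((1 - t ^+ 2) `^ (s - 1))%:E *
      \sum_(k <oo) (2 * (c * t) ^+ (2 * k) / (2 * k)`!%:R)%:E)%E.
    rewrite -nneseriesZl//; last first.
      by move=> k _; rewrite lee_fin divr_ge0// mulr_ge0.
    apply: eq_eseriesr => k _; rewrite -!EFinM; congr EFin.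
    have -> : k%:R + 2^-1 + (k%:R + 2^-1) - 1 = (2 * k)%:R :> R.
      by rewrite natrM; field.
    by rewrite powR_mulrn ?(ltW t_gt0)// exprMn; ring.
  rewrite cosh_series -EFinM; congr EFin.
  by rewrite sqrrN mulrN mulrDr.
have cvgE : (EFin \o series u @ \oo --> (poisson_integral c s)%:E)%E.
  rewrite -sumE; have -> : EFin \o series u = (fun n => \sum_(0 <= k < n) (u k)%:E)%E.
    by apply/funext => n; rewrite /= sumEFin.
  by apply: is_cvg_nneseries => n _ _; rewrite lee_fin.
by move/fine_cvgP : cvgE => [].
Qed.

Lemma BesselI_poisson (m q c : R) : - 2^-1 < m -> 0 < q -> c ^+ 2 = 4 * q ^+ 2 ->
  BesselI m (2 * q) =
  q `^ m / (Gamma 2^-1 * Gamma (m + 2^-1)) * poisson_integral c (m + 2^-1).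
Proof.
move=> m_gt q_gt0 cq; have s_gt0 : 0 < m + 2^-1 by rewrite -ltrBlDr sub0r.
have half_gt0 : 0 < 2^-1 :> R by rewrite invr_gt0.
(* The k-th terms compared as rational expressions, with Q = q^(2k), P = q^m, K = 4^k, F = (2k)!, f
   = k!, G0 = Gamma(1/2), Gs = Gamma(m + 1/2) and Gm = Gamma(m + k + 1). *)
have alg (Q P K F G0 Gs Gm f : R) : K != 0 -> F != 0 -> G0 != 0 -> Gs != 0 ->
    Gm != 0 -> f != 0 ->
    Q * P / (f * Gm) = P / (G0 * Gs) * (K * Q / F * (Gs * (G0 * F / (K * f)) / Gm)).
  by move=> *; field; do !(apply/andP; split).
have Gamma_neq0 a : 0 < a -> Gamma a != 0 by move=> ?; rewrite gt_eqF// Gamma_gt0.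
have fact_neq0 k : k`!%:R != 0 :> R by rewrite pnatr_eq0 -lt0n fact_gt0.
apply/cvg_lim => //; set A := q `^ m / _.
rewrite (_ : series _ = fun n => A * series (fun k => c ^+ (2 * k) / (2 * k)`!%:R *
    Beta (m + 2^-1) (k%:R + 2^-1)) n).
  by apply: cvgMl_tmp; exact: poisson_series.
apply/funext => n; rewrite /series/= mulr_sumr; apply: eq_bigr => k _.
rewrite /Beta Gamma_half (_ : 2 * q / 2 = q); last by field.
rewrite (_ : m + 2^-1 + (k%:R + 2^-1) = m + k%:R + 1); last by field.
rewrite [c ^+ _]exprM cq exprMn -exprM powRD_gt0// -natrM powR_mulrn ?(ltW q_gt0)//.
by apply: alg; rewrite ?expf_neq0 ?fact_neq0 ?Gamma_neq0 ?pnatr_eq0//;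
  have := ler0n R k; lra.
Qed.

End poisson.

(** * Differentiating Poisson's formula in the order *)

Lemma is_derive_poisson_integral {R : realType} (c s : R) : 0 < s ->
  is_derive s 1 (poisson_integral c)
    (\int[lebesgue_measure]_(t in `]-1, 1[)
       ((1 - t ^+ 2) `^ (s - 1) * ln (1 - t ^+ 2) * expR (c * t))).
Proof.
move=> s_gt0.
exact: (@is_derive_mellin R _ _ lebesgue_measure _
  (fun t => 1 - t ^+ 2) (fun t => expR (c * t)) (measurable_itv _)
  (@one_sub_sqr_gt0 R) (fun t => expR_ge0 _) (integrable_poisson c) s s_gt0).
Qed.

Lemma integrable_poisson_ln {R : realType} (c s : R) : 0 < s ->
  lebesgue_measure.-integrable `]-1, 1[
    (fun t => ((1 - t ^+ 2) `^ (s - 1) * ln (1 - t ^+ 2) * expR (c * t))%:E).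
Proof.
move=> s_gt0.
apply: (@integrable_mellin_ln R _ _ lebesgue_measure _
  (fun t => 1 - t ^+ 2) (fun t => expR (c * t)) (measurable_itv _)
  (@one_sub_sqr_gt0 R) (fun t => expR_ge0 _) (integrable_poisson c) s s_gt0).
- by apply: measurable_funB => //; exact: exprn_measurable.
- exact: measurable_expM.
Qed.

Theorem theorem27 (R : realType) (mu x : R) (mu_ge0 : 0 <= mu) (x_neq0 : x != 0) :
  (\int[lebesgue_measure]_(t in `](-1)%R, 1%R[)
      (expR (x * t / 2) * (1 - t ^+ 2) `^ (mu - 1 / 2) * ln (1 - t ^+ 2))%:E
   = (Beta (mu + 1 / 2) (mu + 1 / 2) * Gamma (1 + mu) * (16 / `|x|) `^ mu *
        (BesselI mu (`|x| / 2) * (digamma (mu + 1 / 2) + ln (4 / `|x|))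
         + dBesselI_order mu (`|x| / 2)))%:E)%E.
Proof.
rewrite !div1r; set s := mu + 2^-1.
have s_gt0 : 0 < s by rewrite ltr_wpDl// invr_gt0.
have half_gt0 : 0 < 2^-1 :> R by rewrite invr_gt0.
have x_gt0 : 0 < `|x| by rewrite normr_gt0.
(* Half the Bessel argument |x|/2, the quantity that is raised to powers in the series. *)
pose q := `|x| / 4; have q_gt0 : 0 < q by rewrite divr_gt0.
pose c := x / 2.
have cq : c ^+ 2 = 4 * q ^+ 2.
  by rewrite /c /q !exprMn real_normK ?num_real//; field.
have zE : `|x| / 2 = 2 * q by rewrite /q; field.
pose dJ : R := \int[lebesgue_measure]_(t in `]-1, 1[)
  ((1 - t ^+ 2) `^ (s - 1) * ln (1 - t ^+ 2) * expR (c * t)).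
(* Integrability with the logarithm makes the extended-real integral of the claim finite, hence
   equal to the real integral [dJ]. *)
transitivity dJ%:E.
  rewrite /dJ /Rintegral fineK; last first.
    exact: integrable_fin_num (integrable_poisson_ln c s_gt0).
  apply: eq_integral => t _; congr EFin.
  rewrite (_ : s - 1 = mu - 2^-1); last by rewrite /s; field.
  by rewrite (_ : c * t = x * t / 2); [ring|rewrite /c; field].
congr EFin.
have BE m : - 2^-1 < m -> BesselI m (`|x| / 2) =
    q `^ m / (Gamma 2^-1 * Gamma (m + 2^-1)) * poisson_integral c (m + 2^-1).
  by move=> m_gt; rewrite zE; exact: BesselI_poisson.
have dG : is_derive s 1 Gamma (derive1 Gamma s).
  by rewrite derive1E; apply/derivableP; exact: derivable_Gamma.
have dsh : is_derive mu 1 (fun m : R => m + 2^-1) 1.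
  exact: is_derive_shift.
have dGs : is_derive mu 1 (fun m => Gamma (m + 2^-1)) (derive1 Gamma s).
  rewrite -[derive1 _ _]mulr1.
  exact: (@is_derive1_comp R Gamma (fun m : R => m + 2^-1) mu _ _ dG dsh).
have dJs : is_derive mu 1 (fun m => poisson_integral c (m + 2^-1)) dJ.
  rewrite -[dJ]mulr1.
  exact: (@is_derive1_comp R (poisson_integral c) (fun m : R => m + 2^-1) mu _ _
    (is_derive_poisson_integral c s_gt0) dsh).
have G0 : Gamma 2^-1 != 0 :> R by rewrite gt_eqF// Gamma_gt0.
have Gs : Gamma s != 0 by rewrite gt_eqF// Gamma_gt0.
have Gmu : Gamma (mu + 1) != 0 by rewrite gt_eqF// Gamma_gt0// ltr_wpDl.
have GG : Gamma 2^-1 * Gamma (mu + 2^-1) != 0 by exact: (mulf_neq0 G0 Gs).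
have dI : dBesselI_order mu (`|x| / 2) = q `^ mu / (Gamma 2^-1 * Gamma s) *
   (ln q * poisson_integral c s - derive1 Gamma s / Gamma s * poisson_integral c s + dJ).
  rewrite /dBesselI_order derive1E; apply: (@derive_val).
  (* Poisson's formula holds on a neighbourhood of [mu], since mu >= 0 > -1/2; so the Bessel
     function inherits differentiability from the product. *)
  apply: (@near_eq_is_derive _ _ _ (fun m => q `^ m / (Gamma 2^-1 * Gamma (m + 2^-1)) *
      poisson_integral c (m + 2^-1))).
    near=> m; apply/esym/BE; near: m; apply: lt_nbhsr.
    by rewrite (lt_le_trans _ mu_ge0)// oppr_lt0.
  apply: is_derive_eq; rewrite /GRing.scale/= -/s.
  move: G0 Gs; move: (Gamma 2^-1) (Gamma s) (derive1 Gamma s) => g0 gs g's g00 gs0.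
  by field; rewrite g00 gs0.
(* As ln(4/|x|) = - ln q, the bracket psi(s) - ln q times I_mu cancels the two J(s) terms of the
   derivative. Only [dJ] remains, with a factor that the identities below show to be 1. *)
rewrite dI BE; last by rewrite (lt_le_trans _ mu_ge0)// oppr_lt0.
rewrite -/s.
have -> : ln (4 / `|x|) = - ln q.
  by rewrite -lnV ?posrE// /q invf_div.
have B : Beta s s = 2 * (Gamma s * Gamma 2^-1 / Gamma (mu + 1)) / (2 `^ s * 2 `^ s).
  have := Beta_duplication s_gt0; rewrite powRD_gt0// /Beta.
  have -> : s + 2^-1 = mu + 1 by rewrite /s; field.
  move=> <-.
  have : Gamma (s + s) != 0 by rewrite gt_eqF// Gamma_gt0// addr_gt0.
  have : 2 `^ s != 0 :> R by rewrite gt_eqF// powR_gt0.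
  move: (Gamma (s + s)) (Gamma s) (2 `^ s) => g2 g1 p p0 g20.
  by field; rewrite p0 g20.
(* Here (16/|x|) q = 4 and 4^mu = 2^(2s-1), which cancels the power of 2 from the duplication
   formula. *)
have pw : (16 / `|x|) `^ mu * q `^ mu = 2 `^ s * 2 `^ s / 2.
  rewrite -powRM ?divr_ge0 ?ltW// (_ : 16 / `|x| * q = 2 * 2); last first.
    by rewrite /q; field; rewrite gt_eqF.
  rewrite powRM// -!powRD_gt0//.
  have -> : s + s = mu + mu + 1 by rewrite /s; field.
  by rewrite [2 `^ (_ + 1)]powRD_gt0// powRr1//; field.
have p2 : 2 `^ s != 0 :> R by rewrite gt_eqF// powR_gt0.
have p3 : q `^ mu != 0 by rewrite gt_eqF// powR_gt0.
have -> : (16 / `|x|) `^ mu = 2 `^ s * 2 `^ s / 2 / q `^ mu by rewrite -pw mulfK.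
rewrite B [1 + mu]addrC /digamma; move: p2 p3 G0 Gs Gmu.
move: (2 `^ s) (q `^ mu) (Gamma 2^-1) (Gamma s) (Gamma (mu + 1)) (derive1 Gamma s).
move=> p2 qm g0 gs gm g's p20 qm0 g00 gs0 gm0.
by field; rewrite p20 qm0 g00 gs0 gm0.
Unshelve. all: by end_near. Qed.
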